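(* Let $\mathbf{Fin}\subseteq\mathbf{AF}$ be the subspace of finite quivers, and let $\sim$ be the equivalence relation on $\mathbf{Fin}$ generated by finite mutation-equivalence and isomorphism; give $\mathbf{Fin}/\!\sim$ the quotient topology. Then the map $f:\mathbf{Fin}/\!\sim\;\to\mathcal M'$ sending $[Q]_\sim$ to the mutation class of $Q'$, where $Q'$ is the quiver obtained from $Q$ by removing all isolated vertices if $Q$ has at least one arrow, and $Q'$ is the one-vertex quiver if $Q$ has no arrows, is a well-defined homeomorphism.
   Context: $\mathbb{N}$ is the positive integers. A quiver on a set $X$ is a function $Q:X\times X\to\mathbb{Z}$ with $Q(x,y)=-Q(y,x)$. $\mathbf{AF}$ is the set of quivers on $\mathbb{N}$ with the topology generated by the basic sets $U_{Q,V}=\{Q':Q'(x,y)=Q(x,y)\ \forall x,y\in V\}$, $V$ finite. A quiver on $\mathbb{N}$ is finite if $\sum_{x,y}|Q(x,y)|<\infty$. A vertex $x$ is isolated if $Q(x,y)=0$ for all $y$. Mutation at $x$: $\mu_x(Q)(v,w)=-Q(v,w)$ if $x\in\{v,w\}$, otherwise $Q(v,w)+Q(v,x)[Q(x,w)]_++[-Q(v,x)]_+Q(x,w)$, $[a]_+=\max(a,0)$; two quivers are mutation-equivalent if related by a finite sequence of mutations. For a quiver $Q$ on $[n]=\{1,\dots,n\}$ ($n\ge1$), its mutation class $[Q]$ is the set of quivers on $[n]$ mutation-equivalent to an isomorphic copy of $Q$; $\mathcal M$ is the set of all such classes. Write $[P]\preceq[Q]$ if $P$ is isomorphic to a full subquiver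 (restriction to a vertex subset) of $Q$; $\mathcal M$ carries the topology whose open sets are the upward-closed subsets of $(\mathcal M,\preceq)$. $\mathcal M'\subseteq\mathcal M$ is the subspace of classes of quivers with no isolated vertices together with the class of the one-vertex quiver. *)

(* Defs.v *)
From HB Require Import structures.
From mathcomp Require Import all_boot all_order all_algebra.
From mathcomp Require Import ring.
From mathcomp Require Import boolp classical_sets functions cardinality.
From mathcomp Require Import reals constructive_ereal ereal topology esum Rstruct.
From Stdlib Require Import Relation_Operators.

Set Implicit Arguments.
Unset Strict Implicit.
Unset Printing Implicit Defensive.

Import Order.TTheory GRing.Theory Num.Theory.
Local Open Scope classical_set_scope.
Local Open Scope quotient_scope.
Local Open Scope ring_scope.

Record quiver (X : Type) := Quiver {
  arrows :> X -> X -> int;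
  arrowsN : forall x y, arrows x y = - arrows y x }.

Lemma quiverP (X : Type) (P Q : quiver X) : (forall x y, P x y = Q x y) -> P = Q.
Proof.
case: P Q => [p pN] [q qN] /= pq.
have e : p = q by apply/funext => x; apply/funext => y; exact: pq.
by subst q; congr Quiver; exact: Prop_irrelevance.
Qed.

Definition zero_quiver (X : Type) : quiver X :=
  @Quiver X (fun _ _ => 0) (fun _ _ => esym (oppr0 _)).

HB.instance Definition _ (X : Type) := gen_eqMixin (quiver X).
HB.instance Definition _ (X : Type) := gen_choiceMixin (quiver X).
HB.instance Definition _ (X : Type) := isPointed.Build (quiver X) (zero_quiver X).

Definition isolated_vertex (X : Type) (Q : quiver X) (x : X) : Prop :=
  forall y, Q x y = 0.

Definition has_arrow (X : Type) (Q : quiver X) : Prop :=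
  exists x y, Q x y <> 0.

Definition full_subquiver (X : Type) (Q : quiver X) (V : set X) : quiver V :=
  @Quiver V (fun x y => Q (val x) (val y)) (fun x y => arrowsN Q (val x) (val y)).

Definition remove_isolated (X : Type) (Q : quiver X) :=
  full_subquiver Q [set x | ~ isolated_vertex Q x].

Definition isomorphic (X Y : Type) (P : quiver X) (Q : quiver Y) : Prop :=
  exists2 h : X -> Y, bijective h & forall x y, P x y = Q (h x) (h y).

Section mutation.
Variable X : eqType.
Implicit Types (Q : quiver X) (x v w : X).

Definition pos_part (a : int) : int := Num.max a 0.

Definition mutate_arrows Q x v w : int :=
  if x \in [:: v; w] then - Q v w
  else Q v w + Q v x * pos_part (Q x w) + pos_part (- Q v x) * Q x w.

Lemma mutate_arrowsN Q x v w : mutate_arrows Q x v w = - mutate_arrows Q x w v.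
Proof.
rewrite /mutate_arrows !inE orbC (arrowsN Q v w); case: ifP => // _.
rewrite (arrowsN Q v x) (arrowsN Q w x) !opprK; ring.
Qed.

Definition mutate Q x : quiver X := Quiver (mutate_arrowsN Q x).

Definition mutation_equivalent (P Q : quiver X) : Prop :=
  exists s : seq X, foldl mutate P s = Q.

End mutation.

(** The vertices 1, 2, 3, ... are numbered from 0, both here ([nat]) and for
    quivers on [n] vertices (['I_n]). *)
Definition AF : Type := quiver nat.

HB.instance Definition _ := Choice.on AF.

Definition AF_basic (i : quiver nat * set nat) : set AF :=
  [set Q' : AF | forall x y, i.2 x -> i.2 y -> Q' x y = i.1 x y].

Lemma AF_basic_cover :
  \bigcup_(i in [set i | finite_set i.2]) AF_basic i = setT.
Proof.
by apply/seteqP; split=> // Q _; exists (Q, set0) => //=; exact: finite_set0.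
Qed.

Lemma AF_basic_join (i j : quiver nat * set nat) (Q : AF) :
  [set i | finite_set i.2] i -> [set i | finite_set i.2] j ->
  AF_basic i Q -> AF_basic j Q ->
  exists k, [/\ [set i | finite_set i.2] k, AF_basic k Q &
                AF_basic k `<=` AF_basic i `&` AF_basic j].
Proof.
move=> /= fi fj iQ jQ; exists (Q, i.2 `|` j.2); split => //=.
  by rewrite finite_setU.
move=> Q' Q'Q; split=> x y xV yV.
  by rewrite Q'Q ?iQ//=; left.
by rewrite Q'Q ?jQ//=; right.
Qed.

HB.instance Definition _ :=
  isBaseTopological.Build AF AF_basic_cover AF_basic_join.

Definition finite_quiver (Q : AF) : Prop :=
  (\esum_(p in [set: nat * nat]) (`|Q p.1 p.2|%:~R : Rdefinitions.R)%:E < +oo)%E.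

(** Subspaces ([Fin] here, [Mprime] below) are coerced to [set_type], which the
    library equips with the initial topology of the inclusion map. *)
Definition Fin : Type := [set Q : AF | finite_quiver Q].

HB.instance Definition _ := Topological.on Fin.

Definition fin_step (P Q : Fin) : Prop :=
  mutation_equivalent (val P : AF) (val Q) \/ isomorphic (val P : AF) (val Q : AF).

Definition fin_sim (P Q : Fin) : bool :=
  `[< clos_refl_sym_trans Fin fin_step P Q >].

Lemma fin_sim_refl : reflexive fin_sim.
Proof. by move=> P; apply/asboolP; exact: rst_refl. Qed.

Lemma fin_sim_sym : symmetric fin_sim.
Proof. by move=> P Q; apply/asboolP/asboolP; exact: rst_sym. Qed.

Lemma fin_sim_trans : transitive fin_sim.
Proof.
move=> Q P R /asboolP PQ /asboolP QR; apply/asboolP; exact: rst_trans PQ QR.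
Qed.

Canonical fin_sim_equiv :=
  EquivRel fin_sim fin_sim_refl fin_sim_sym fin_sim_trans.

Definition FinSim : topologicalType := quotient_topology {eq_quot fin_sim_equiv}.

Definition fin_class (Q : Fin) : FinSim := \pi_({eq_quot fin_sim_equiv}) Q.

(** [Q] may live on any vertex type; the class is nonempty exactly when that
    type has [n] elements.  For [X = 'I_n] this is the usual class [[Q]]. *)
Definition mutation_class (X : Type) (Q : quiver X) (n : nat) :
    set (quiver 'I_n) :=
  [set P | exists2 P0 : quiver 'I_n, isomorphic P0 Q & mutation_equivalent P0 P].

Arguments mutation_class {X} Q n _.

Record mclass := MClass {
  mc_size : nat;
  mc_set :> set (quiver 'I_mc_size);
  mcP : (0 < mc_size)%N /\
        exists Q : quiver 'I_mc_size, mc_set = mutation_class Q mc_size }.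

Arguments mc_set : clear implicits.

Definition mclass_of (n : nat) (n_gt0 : (0 < n)%N) (Q : quiver 'I_n) : mclass :=
  MClass (conj n_gt0 (ex_intro _ Q erefl)).

Definition one_vertex_class : mclass := @mclass_of 1 isT (zero_quiver 'I_1).

HB.instance Definition _ := gen_eqMixin mclass.
HB.instance Definition _ := gen_choiceMixin mclass.

Definition mclass_le (A B : mclass) : Prop :=
  exists P Q, [/\ mc_set A P, mc_set B Q &
    exists V : set 'I_(mc_size B), isomorphic P (full_subquiver Q V)].

Definition upward_closed (U : set mclass) : Prop :=
  forall A B, U A -> mclass_le A B -> U B.

Lemma upward_closedT : upward_closed setT.
Proof. by []. Qed.

Lemma upward_closedI : setI_closed upward_closed.
Proof.
move=> U V Uup Vup A B [UA VA] AB.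
by split; [exact: Uup UA AB|exact: Vup VA AB].
Qed.

Lemma upward_closed_bigcup (I : Type) (U : I -> set mclass) :
  (forall i, upward_closed (U i)) -> upward_closed (\bigcup_i U i).
Proof. by move=> Uup A B [i _ UA] AB; exists i => //; exact: Uup UA AB. Qed.

HB.instance Definition _ := isOpenTopological.Build mclass
  upward_closedT upward_closedI upward_closed_bigcup.

Definition Mprime : set mclass := [set A |
  (exists2 Q, mc_set A Q & forall x, ~ isolated_vertex Q x) \/ A = one_vertex_class].

(** As the set of a [mclass] is never empty, the first equation also forces
    [mc_size A] to be the number of non-isolated vertices of [Q]. *)
Definition is_reduced_class (X : Type) (Q : quiver X) (A : mclass) : Prop :=
  (has_arrow Q -> mc_set A = mutation_class (remove_isolated Q) (mc_size A)) /\
  (~ has_arrow Q -> A = one_vertex_class).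

Definition homeomorphism (S T : topologicalType) (f : S -> T) : Prop :=
  exists g : T -> S, [/\ cancel f g, cancel g f, continuous f & continuous g].

(* Main.v *)
(** A finite quiver on the naturals realizes a class [A] if it extends by zero a
    member of [A] placed along some injection ['I_n -> nat].  Mutation commutes
    with such extensions, and any two of them differ by a bijection of [nat], so
    realizing [A] depends only on the [fin_sim]-class, and two quivers realizing
    [A] are [fin_sim]-equivalent.  For [A] in [Mprime], realizing [A] means that
    [A] is the reduced class.
    A window [0, N) containing the support of [Q] forces every quiver agreeing
    with [Q] there to contain [Q] as a full subquiver, so the map is continuous.
    Conversely, a window only constrains finitely many vertices, so a quiver
    containing [P] can be placed so as to agree with a given copy of [P] on it,
    its other vertices being sent far away: the map is open. *)
Require Import Defs.
From mathcomp Require Import all_boot all_order all_algebra.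
From mathcomp Require Import ring zify finmap.
From mathcomp Require Import boolp classical_sets cardinality fsbigop.
From mathcomp Require Import constructive_ereal ereal topology esum Rstruct.
From Stdlib Require Import Relation_Operators.

Set Implicit Arguments.
Unset Strict Implicit.
Unset Printing Implicit Defensive.

Import Order.TTheory GRing.Theory Num.Theory.
Local Open Scope classical_set_scope.
Local Open Scope ring_scope.

(** * Mutation as an involution, and isolated vertices *)

Lemma mutateE (X : eqType) (Q : quiver X) (x v w : X) :
  mutate Q x v w = if x \in [:: v; w] then - Q v w
    else Q v w + Q v x * pos_part (Q x w) + pos_part (- Q v x) * Q x w.
Proof. by []. Qed.

(** The first mutation negates the arrows at [x]; with [[-a]_+ = [a]_+ - a] the two correction terms
    then cancel. *)
Lemma mutateK (X : eqType) (x : X) : involutive (fun Q : quiver X => mutate Q x).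
Proof.
move=> Q; apply: quiverP => v w; rewrite !mutateE !inE !eqxx !orbT /=.
case: (_ || _); first by rewrite opprK.
have posN a : pos_part (- a) = pos_part a - a.
  by rewrite /pos_part; lia.
by rewrite opprK !posN; ring.
Qed.

Lemma mutate_isolated (X : eqType) (Q : quiver X) (x : X) :
  isolated_vertex Q x -> mutate Q x = Q.
Proof.
move=> Qx; apply: quiverP => v w; rewrite mutateE !inE.
have Qx' y : Q y x = 0 by rewrite arrowsN Qx oppr0.
rewrite Qx Qx' oppr0 /pos_part maxxx !mul0r !addr0.
by case: ifP => // /orP[]/eqP<-; rewrite ?Qx ?Qx' oppr0.
Qed.

Lemma isolated_mutate (X : eqType) (Q : quiver X) (x y : X) :
  isolated_vertex Q y -> isolated_vertex (mutate Q x) y.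
Proof.
move=> Qy w; rewrite mutateE !Qy.
by case: ifP => _; rewrite /pos_part ?oppr0 ?maxxx ?mul0r ?addr0.
Qed.

(** Mutation preserves isolation and is its own inverse, so it also reflects it. *)
Lemma isolated_foldl_mutate (X : eqType) (Q : quiver X) (s : seq X) (y : X) :
  isolated_vertex (foldl (@mutate _) Q s) y <-> isolated_vertex Q y.
Proof.
elim: s Q => [//|x s IHs] Q /=; rewrite IHs; split; last exact: isolated_mutate.
by move=> /(isolated_mutate x); rewrite mutateK.
Qed.

Lemma foldl_mutateK (X : eqType) (s : seq X) (Q : quiver X) :
  foldl (@mutate _) (foldl (@mutate _) Q s) (rev s) = Q.
Proof.
by elim: s Q => [//|x s IHs] Q /=; rewrite rev_cons -cats1 foldl_cat IHs /= mutateK.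
Qed.

Lemma mutation_equivalent_sym (X : eqType) (P Q : quiver X) :
  mutation_equivalent P Q -> mutation_equivalent Q P.
Proof. by move=> [s <-]; exists (rev s); rewrite foldl_mutateK. Qed.

Lemma mutation_equivalent_trans (X : eqType) (P Q R : quiver X) :
  mutation_equivalent P Q -> mutation_equivalent Q R -> mutation_equivalent P R.
Proof. by move=> [s <-] [t <-]; exists (s ++ t); rewrite foldl_cat. Qed.

(** * Isomorphisms and extensions by zero *)

Section isomorphic.
Variables (X Y Z : Type).
Implicit Types (P : quiver X) (Q : quiver Y) (R : quiver Z).

Lemma isomorphic_refl P : isomorphic P P.
Proof. by exists id => //; exists id. Qed.

Lemma isomorphic_sym P Q : isomorphic P Q -> isomorphic Q P.
Proof.
by move=> [h [g hK gK] PQ]; exists g => [|x y]; [exists h|rewrite PQ !gK].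
Qed.

Lemma isomorphic_trans P Q R : isomorphic P Q -> isomorphic Q R -> isomorphic P R.
Proof.
move=> [h hb PQ] [k kb QR]; exists (k \o h); first exact: bij_comp.
by move=> x y; rewrite PQ QR.
Qed.

End isomorphic.

(** The extension by zero of [P] along [h], as a relation. Isomorphisms are the case of bijective
    [h], so mutations are transported along both in the same way. *)
Definition extension (Y X : Type) (h : Y -> X) (P : quiver Y) (Q : quiver X) :=
  [/\ injective h, forall i j, Q (h i) (h j) = P i j &
      forall x, (forall i, h i <> x) -> isolated_vertex Q x].

Section extension.
Variables (Y X : Type).
Implicit Types (h : Y -> X) (P : quiver Y) (Q : quiver X).

Lemma extension_exists h P : injective h -> exists Q, extension h P Q.
Proof.
move=> hI.
(* The partial inverse of [h], undefined outside its image. *)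
pose inv x : option Y :=
  if pselect (exists i, h i = x) is left e then Some (projT1 (cid e)) else None.
have invE i : inv (h i) = Some i.
  rewrite /inv; case: pselect => [e|[]]; last by exists i.
  by congr Some; apply: hI; case: cid.
have inv0 x : (forall i, h i <> x) -> inv x = None.
  by rewrite /inv; case: pselect => // -[i hi] /(_ i).
pose q x y := if inv x is Some i then if inv y is Some j then P i j else 0 else 0.
have qN x y : q x y = - q y x.
  by rewrite /q; case: (inv x) => [i|]; case: (inv y) => [j|]; rewrite ?oppr0 1?arrowsN.
exists (Quiver qN); split => // [i j|x hx y] /=; first by rewrite /q !invE.
by rewrite /q inv0.
Qed.

Lemma isomorphic_extension h P Q :
  bijective h -> (forall x y, P x y = Q (h x) (h y)) -> extension h P Q.
Proof.
move=> hb PQ; split => [|//|x hx]; first exact: bij_inj.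
by case: hb => g _ /(_ x) /hx.
Qed.

Lemma extension_isomorphic h P Q : bijective h -> extension h P Q -> isomorphic P Q.
Proof. by move=> hb [_ PQ _]; exists h. Qed.

Lemma extension_eq h P Q (Q' : quiver X) :
  extension h P Q -> extension h P Q' -> Q = Q'.
Proof.
move=> [hI PQ Q0] [_ PQ' Q'0]; apply: quiverP => x y.
have [[i <-]|/forallNP hx] := pselect (exists i, h i = x); last first.
  by rewrite Q0 ?Q'0.
have [[j <-]|/forallNP hy] := pselect (exists j, h j = y); last first.
  by rewrite arrowsN Q0// arrowsN Q'0.
by rewrite PQ PQ'.
Qed.

Lemma extension_isolated h P Q i :
  extension h P Q -> isolated_vertex Q (h i) -> isolated_vertex P i.
Proof. by move=> [_ PQ _] Qi j; rewrite -PQ Qi. Qed.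

Lemma extension_comp Z (k : X -> Z) h P Q (R : quiver Z) :
  extension h P Q -> extension k Q R -> extension (k \o h) P R.
Proof.
move=> [hI PQ Q0] [kI QR R0]; split => [|i j|z kz /= w].
- exact: inj_comp.
- by rewrite /= QR PQ.
have [[x xz]|/forallNP/R0->//] := pselect (exists x, k x = z).
have [[y <-]|/forallNP/R0 R0w] := pselect (exists y, k y = w); last first.
  by rewrite arrowsN R0w.
by rewrite -xz QR Q0 // => i hx; apply: (kz i); rewrite /= hx.
Qed.

End extension.

(** Arrows at [h i] stay within the image of [h], so mutation there sees only [P]; the vertices
    outside remain isolated. *)
Lemma extension_mutate (Y X : eqType) (h : Y -> X) (P : quiver Y) (Q : quiver X) i :
  extension h P Q -> extension h (mutate P i) (mutate Q (h i)).
Proof.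
move=> [hI PQ Q0]; split => // [v w|x hx]; last exact/isolated_mutate/Q0.
by rewrite !mutateE !inE !(inj_eq hI) !PQ.
Qed.

Lemma extension_foldl_mutate (Y X : eqType) (h : Y -> X) P Q (s : seq Y) :
  extension h P Q -> extension h (foldl (@mutate _) P s) (foldl (@mutate _) Q (map h s)).
Proof. by elim: s P Q => [//|i s IHs] P Q /(extension_mutate i)/IHs. Qed.

(* [h] and [k] need not have disjoint images, but both are disjoint from a
   shifted copy of [h], and disjoint embeddings are exchanged by an involution. *)
Lemma extension_nat_isomorphic n (h k : 'I_n -> nat) P (Q R : quiver nat) :
  extension h P Q -> extension k P R -> isomorphic Q R.
Proof.
have swap (h1 h2 : 'I_n -> nat) (Q1 Q2 : quiver nat) :
    (forall i j, h1 i <> h2 j) ->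
    extension h1 P Q1 -> extension h2 P Q2 -> isomorphic Q1 Q2.
  move=> h12 e1 e2; have [[I1 _ _] [I2 _ _]] := (e1, e2).
  pose b x := if [pick i | h1 i == x] is Some i then h2 i
    else if [pick i | h2 i == x] is Some i then h1 i else x.
  have b1 i : b (h1 i) = h2 i.
    by rewrite /b; case: pickP => [j /eqP/I1->//|/(_ i)]; rewrite eqxx.
  have b2 i : b (h2 i) = h1 i.
    rewrite /b; case: pickP => [j /eqP/h12//|_].
    by case: pickP => [j /eqP/I2->//|/(_ i)]; rewrite eqxx.
  have b0 x : (forall i, h1 i <> x) -> (forall i, h2 i <> x) -> b x = x.
    move=> h1x h2x; rewrite /b; case: pickP => [j /eqP/h1x//|_].
    by case: pickP => [j /eqP/h2x//|].
  have bK : involutive b.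
    move=> x; have [[i <-]|/forallNP h1x] := pselect (exists i, h1 i = x).
      by rewrite b1 b2.
    have [[i <-]|/forallNP h2x] := pselect (exists i, h2 i = x).
      by rewrite b2 b1.
    by rewrite !b0.
  exists b; first by exists b.
  (* Transporting [Q1] along [b] extends [P] along [b \o h1 = h2], so uniqueness of extensions
     identifies the result with [Q2]. *)
  have [Q' eQ'] := extension_exists Q1 (inv_inj bK).
  have : extension h2 P Q'.
    by have := extension_comp e1 eQ'; rewrite (_ : b \o h1 = h2)//; apply/funext.
  by move=> /(extension_eq e2) -> x y; case: eQ' => _ ->.
move=> eh ek; have [hI _ _] := eh.
(* [N] exceeds all values of [h] and [k], so [N + h] has image disjoint from both. *)
pose N := (\sum_i (h i + k i)).+1%N.
have Nh i : (h i < N)%N by rewrite ltnS (bigD1 i)//= -addnA leq_addr.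
have Nk i : (k i < N)%N by rewrite ltnS (bigD1 i)//= addnAC leq_addl.
have [|S eS] := @extension_exists _ _ (fun i => N + h i)%N P.
  by move=> i j /addnI/hI.
apply: (@isomorphic_trans _ _ _ _ S).
  by apply: swap eh eS => i j; have := Nh i; lia.
by apply: isomorphic_sym; apply: swap ek eS => i j; have := Nk i; lia.
Qed.

(** * Finiteness and bounded support *)

Lemma finite_set_nat_bound (S : set nat) :
  finite_set S -> exists N, forall x, S x -> (x < N)%N.
Proof.
move=> /finite_seqP[s ->]; exists (\sum_(x <- s) x).+1 => x /= xs.
by rewrite ltnS (big_rem x)//= leq_addr.
Qed.

(** Each nonzero arrow adds at least 1 to the sum, so an infinite support would push it past every
    integer. By antisymmetry the bound holds for [y] too. *)
Lemma finite_quiver_bound (Q : AF) : finite_quiver Q ->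
  exists N, forall x y, Q x y <> 0 -> (x < N)%N.
Proof.
rewrite /finite_quiver => Qfin.
pose D := [set p : nat * nat | Q p.1 p.2 <> 0].
suff /(finite_image fst)/finite_set_nat_bound[N DN] : finite_set D.
  by exists N => x y Qxy; apply: DN; exists (x, y).
apply: contrapT => Dinf.
have lt_esum n : (n%:R%:E <= \esum_(p in [set: nat * nat])
    (`|Q p.1 p.2|%:~R : Rdefinitions.R)%:E)%E.
  have [B BD leB] := infinite_set_fset n Dinf.
  apply: esum_ge; exists [set` B]; first by split => //; exact: finite_fset.
  rewrite -fsbig_seq ?fset_uniq// sumEFin lee_fin.
  apply: (@le_trans _ _ (\sum_(p <- B) 1)).
    by rewrite big_const_seq count_predT iter_addr_0 ler_nat.
  rewrite !big_seq; apply: ler_sum => p pB; rewrite -[1]/(1%:~R) ler_int.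
  by rewrite -gtz0_ge1 normr_gt0; apply/eqP; exact: BD.
set e := esum _ _ in Qfin lt_esum.
have e_fin : e \is a fin_num.
  by rewrite ge0_fin_numE//; exact: lt_esum 0%N.
have := lt_esum (Num.truncn (fine e)).+1.
by rewrite -(fineK e_fin) lee_fin leNgt truncnS_gt.
Qed.

(** Arrows join only image vertices, so the sum reduces to a finite set of pairs. *)
Lemma extension_finite n (h : 'I_n -> nat) P (Q : AF) :
  extension h P Q -> finite_quiver Q.
Proof.
move=> [_ _ Q0]; rewrite /finite_quiver.
pose F := range (fun i : 'I_n * 'I_n => (h i.1, h i.2)).
have Ffin : finite_set F by apply: finite_image; exact: finite_finset.
have -> : \esum_(p in [set: nat * nat]) (`|Q p.1 p.2|%:~R : Rdefinitions.R)%:E =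
    \esum_(p in F) (`|Q p.1 p.2|%:~R : Rdefinitions.R)%:E.
  rewrite [RHS]esum_mkcond; apply: eq_esum => -[x y] _ /=; case: ifPn => //.
  rewrite notin_setE => xyF.
  have [[i ix]|/forallNP/Q0->//] := pselect (exists i, h i = x).
  have [[j jy]|/forallNP/Q0] := pselect (exists j, h j = y).
    by exfalso; apply: xyF; exists (i, j) => //=; rewrite ix jy.
  by move=> Qy; rewrite arrowsN Qy.
rewrite esum_fset//.
by rewrite fsbig_finite//= sumEFin ltry.
Qed.

(** * Mutation classes and their members *)

Lemma isomorphic_full_subquiver (Y X : Type) (h : Y -> X) (P : quiver Y)
    (Q : quiver X) (V : set X) :
  injective h -> range h = V -> (forall i j, P i j = Q (h i) (h j)) ->
  isomorphic P (full_subquiver Q V).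
Proof.
move=> hI <- PQ.
have hV i : h i \in range h by apply/mem_set; exists i.
have surj (x : range h) : exists i, h i = val x.
  by have /set_mem[i _ hi] := valP x; exists i.
exists (fun i => SigSub (hV i) : range h) => [|i j]; last by rewrite PQ.
exists (fun x => projT1 (cid (surj x))) => [i|x].
  by case: cid => j /= /hI.
by apply: val_inj; case: cid.
Qed.

Lemma mutation_class_isomorphic (X Y : Type) (P : quiver X) (Q : quiver Y) n :
  isomorphic P Q -> mutation_class P n = mutation_class Q n.
Proof.
move=> PQ; apply/seteqP; split=> R [P0 P0P P0R]; exists P0 => //.
  exact: isomorphic_trans PQ.
exact/(isomorphic_trans P0P)/isomorphic_sym.
Qed.

(** A mutation sequence relabelled along an isomorphism ends at an isomorphic quiver, which can
    serve as the new starting copy. *)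
Lemma mutation_class_mutation n (P Q : quiver 'I_n) :
  mutation_equivalent P Q -> mutation_class P n = mutation_class Q n.
Proof.
suff sub (P' Q' : quiver 'I_n) : mutation_equivalent P' Q' ->
    mutation_class P' n `<=` mutation_class Q' n.
  by move=> PQ; apply/seteqP; split; apply: sub => //; exact: mutation_equivalent_sym.
move=> [s <-] R [P0 /isomorphic_sym[h hb P0P] P0R].
have e := extension_foldl_mutate s (isomorphic_extension hb P0P).
exists (foldl (@mutate _) P0 (map h s)).
  exact/isomorphic_sym/(extension_isomorphic hb e).
by apply: mutation_equivalent_trans P0R; apply: mutation_equivalent_sym; exists (map h s).
Qed.

Lemma mclass_eq (A : mclass) P :
  mc_set A P -> mc_set A = mutation_class P (mc_size A).
Proof.
have [_ [Q ->]] := mcP A => -[P0 P0Q P0P].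
by rewrite -(mutation_class_mutation P0P) (mutation_class_isomorphic _ P0Q).
Qed.

Lemma mclass_nonempty (A : mclass) : exists P, mc_set A P.
Proof.
have [_ [Q ->]] := mcP A.
by exists Q; exists Q; [exact: isomorphic_refl|exists [::]].
Qed.

Lemma quiver_diag (X : Type) (Q : quiver X) (x : X) : Q x x = 0.
Proof. by have := arrowsN Q x x; lia. Qed.

Lemma quiver1_eq0 (P : quiver 'I_1) i j : P i j = 0.
Proof. by rewrite !ord1 quiver_diag. Qed.

(** Mutation and isomorphism both preserve isolation, so the condition that [Mprime] puts on some
    member passes to every member. *)
Lemma mclass_isolated (A : mclass) P P' : mc_set A P -> mc_set A P' ->
  (forall i, ~ isolated_vertex P i) -> forall i, ~ isolated_vertex P' i.
Proof.
move=> /mclass_eq-> [P0 /isomorphic_sym[h hb PP0] [s <-]] Pi i.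
move=> /isolated_foldl_mutate; case: hb => g hK gK; rewrite -(gK i).
by move=> /(extension_isolated (isomorphic_extension (Bijective hK gK) PP0))/Pi.
Qed.

(** * Quivers realizing a mutation class *)

Definition realizes (X : Type) (Q : quiver X) (A : mclass) : Prop :=
  exists2 P, mc_set A P & exists h, extension h P Q.

Lemma is_reduced_class_realizes (Q : quiver nat) (A : mclass) :
  is_reduced_class Q A -> realizes Q A.
Proof.
move=> [arrowA noA]; have [/arrowA eA|noQ] := pselect (has_arrow Q); last first.
  rewrite noA//; exists (zero_quiver 'I_1).
    by exists (zero_quiver 'I_1); [exact: isomorphic_refl|exists [::]].
  have Q0 x y : Q x y = 0 by apply: contrapT => Qxy; apply: noQ; exists x, y.
  exists (@nat_of_ord 1); split => // [|x _ y]; first exact: val_inj.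
  exact: Q0.
(* Nonemptiness of the set supplies a copy [P0] of the reduced quiver on ['I_(mc_size A)]. *)
have [P] := mclass_nonempty A; rewrite eA => -[P0 [h [g hK gK] P0Q] _].
exists P0; first by rewrite eA; exists P0; [exists h => //; exists g|exists [::]].
exists (val \o h); split => // [|x hx].
  exact: inj_comp val_inj (can_inj hK).
apply: contrapT => Qx.
have xV : x \in [set x | ~ isolated_vertex Q x] by exact/mem_set.
by apply: (hx (g (SigSub xV))); rewrite /= gK.
Qed.

(** An arrow of [Q] rules out the one-vertex class, so [P] has no isolated vertex and the image of
    [h] is exactly the set of non-isolated vertices of [Q]. Without arrows every vertex of [P] is
    isolated, which leaves only the one-vertex class. *)
Lemma realizes_is_reduced_class (X : Type) (Q : quiver X) (A : mclass) :
  Mprime A -> realizes Q A -> is_reduced_class Q A.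
Proof.
move=> MA [P AP [h e]]; have [hI PQ Q0] := e; split => [[x [y Qxy]]|noQ].
  have Pi i : ~ isolated_vertex P i.
    case: MA => [[P' AP' P'i]|eA]; first exact: (mclass_isolated AP').
    exfalso; apply: Qxy; subst A.
    have [[i' <-]|/forallNP/Q0->//] := pselect (exists i, h i = x).
    have [[j' <-]|/forallNP/Q0 Qy] := pselect (exists i, h i = y).
      by rewrite PQ quiver1_eq0.
    by rewrite arrowsN Qy.
  rewrite (mclass_eq AP); apply: mutation_class_isomorphic.
  apply: (isomorphic_full_subquiver hI) => //; apply/seteqP; split => z /=.
    by move=> [i _ <-] /(extension_isolated e)/Pi.
  move=> Qz; apply: contrapT => hz; apply: Qz; apply: Q0 => i hi.
  by apply: hz; exists i.
case: MA => // -[P' AP' P'i]; have [A0 _] := mcP A.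
exfalso; apply: (mclass_isolated AP' AP P'i (i := Ordinal A0)) => j.
by rewrite -PQ; apply: contrapT => Qij; apply: noQ; exists (h (Ordinal A0)), (h j).
Qed.

(** The type of the set component depends on the size, so the sets are compared after transport
    along [e]. *)
Lemma mclassP (A B : mclass) (e : mc_size A = mc_size B) :
  eq_rect _ (fun n => set (quiver 'I_n)) (mc_set A) _ e = mc_set B -> A = B.
Proof.
case: A B e => [n A pA] [m B pB] /= e; subst m => /= e; subst B.
by congr MClass; exact: Prop_irrelevance.
Qed.

Lemma is_reduced_class_unique (X : Type) (Q : quiver X) (A B : mclass) :
  is_reduced_class Q A -> is_reduced_class Q B -> A = B.
Proof.
move=> [arrowA noA] [arrowB noB].
have [Qa|noQ] := pselect (has_arrow Q); last by rewrite noA// noB.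
have [[P AP] [P' BP']] := (mclass_nonempty A, mclass_nonempty B).
(* Both classes start from copies of the same reduced quiver, which forces equal numbers of
   vertices. *)
have eAB : mc_size A = mc_size B.
  move: AP BP'; rewrite arrowA// arrowB//.
  move=> [P0 P0Q _] [P1 /isomorphic_sym QP1 _].
  have [h hb _] := isomorphic_trans P0Q QP1.
  by rewrite -[LHS]card_ord -[RHS]card_ord; exact: bij_eq_card hb.
apply: (mclassP (e := eAB)); rewrite arrowA// arrowB//.
by case: _ / eAB.
Qed.

Definition to_Fin (Q : AF) (Qfin : finite_quiver Q) : Fin := SigSub (mem_set Qfin).

(** [P'] is a mutation of a copy [P0] of [P]. Undoing these mutations inside [Q'] gives an extension
    [Q0] of [P0]; [Q] extends [P0] as well, so [Q] and [Q0] are isomorphic. *)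
Lemma realizes_fin_sim (Q Q' : Fin) (A : mclass) :
  realizes (val Q) A -> realizes (val Q') A -> fin_sim Q Q'.
Proof.
move=> [P AP [h e]] [P' AP' [h' e']].
move: AP'; rewrite (mclass_eq AP) => -[P0 [k kb P0P] P0P'].
have [s sE] := mutation_equivalent_sym P0P'.
have e0 := extension_foldl_mutate s e'; rewrite sE in e0.
have e1 := extension_comp (isomorphic_extension kb P0P) e.
pose Q0 := to_Fin (extension_finite e0).
apply/asboolP; apply: (@rst_trans _ _ _ Q0).
  by apply: rst_step; right; exact: extension_nat_isomorphic e1 e0.
by apply: rst_sym; apply: rst_step; left; exists (map h' s).
Qed.

(** Mutation at a vertex outside the image of [h] changes nothing; at [h i] it mutates the member
    [P] within its class. *)
Lemma realizes_mutate (X : eqType) (Q : quiver X) (A : mclass) (s : seq X) :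
  realizes Q A -> realizes (foldl (@mutate _) Q s) A.
Proof.
elim: s Q => [//|x s IHs] Q [P AP [h e]] /=; apply: IHs.
have [[i <-]|/forallNP hx] := pselect (exists i, h i = x); last first.
  by have [_ _ Q0] := e; rewrite mutate_isolated; [exists P => //; exists h|exact: Q0].
exists (mutate P i); last by exists h; exact: extension_mutate.
rewrite (mclass_eq AP); exists P; first exact: isomorphic_refl.
by exists [:: i].
Qed.

Lemma realizes_isomorphic (X Y : Type) (Q : quiver X) (Q' : quiver Y) (A : mclass) :
  isomorphic Q Q' -> realizes Q A -> realizes Q' A.
Proof.
move=> [k kb QQ'] [P AP [h e]]; exists P => //; exists (k \o h).
exact: extension_comp e (isomorphic_extension kb QQ').
Qed.

Lemma fin_sim_realizes (Q Q' : Fin) (A : mclass) :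
  fin_sim Q Q' -> realizes (val Q) A <-> realizes (val Q') A.
Proof.
have sub (P R : Fin) : fin_step P R -> realizes (val P) A -> realizes (val R) A.
  by case=> [[s <-]|iso r]; [exact: realizes_mutate|exact: realizes_isomorphic r].
move=> /asboolP; elim=> {Q Q'} [Q Q' step|//|? ? _ ->//|? ? ? _ -> _ ->//].
split; apply: sub => //.
by case: step => [/mutation_equivalent_sym|/isomorphic_sym]; [left|right].
Qed.

Lemma fin_class_eq (Q Q' : Fin) : fin_class Q = fin_class Q' <-> fin_sim Q Q'.
Proof. by split => [/eqmodP|? //]; last exact/eqmodP. Qed.

Lemma is_reduced_class_exists (Q : Fin) :
  exists2 A, Mprime A & is_reduced_class (val Q) A.
Proof.
have [a|noQ] := pselect (has_arrow (val Q)); last first.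
  by exists one_vertex_class; [right|].
have [N QN] := finite_quiver_bound (set_mem (valP Q)).
(* All non-isolated vertices lie below [N]; their positions in this list label them by
   ['I_(size s)]. *)
pose s := [seq x <- iota 0 N | `[< ~ isolated_vertex (val Q) x >]].
have sP x : (x \in s) <-> ~ isolated_vertex (val Q) x.
  rewrite mem_filter mem_iota /= add0n; split => [/andP[/asboolP]//|Qx].
  apply/andP; split; first exact/asboolP.
  by have /existsNP[y /QN] := Qx.
have s_uniq : uniq s by rewrite filter_uniq// iota_uniq.
pose h (i : 'I_(size s)) := nth 0%N s i.
have hs x : x \in s -> exists i, h i = x.
  move=> xs; have xi : (index x s < size s)%N by rewrite index_mem.
  by exists (Ordinal xi); rewrite /h nth_index.
pose P : quiver 'I_(size s) :=
  @Quiver _ (fun i j => val Q (h i) (h j)) (fun i j => arrowsN (val Q) (h i) (h j)).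
have e : extension h P (val Q).
  split => // [i j /eqP|x hx]; first by rewrite nth_uniq// => /eqP/val_inj.
  by apply: contrapT => /sP/hs[i /hx].
have s_gt0 : (0 < size s)%N.
  have [x [y Qxy]] := a.
  have /hs[i _] : x \in s by apply/sP => /(_ y).
  exact: leq_ltn_trans (ltn_ord i).
have Pi i : ~ isolated_vertex P i.
  have /sP Qi : h i \in s by rewrite mem_nth.
  move=> Pi; apply: Qi => y; apply: contrapT => Qiy.
  (* The other end of an arrow is not isolated either, so the arrow survives in [P]. *)
  have /hs[j jy] : y \in s by apply/sP => /(_ (h i)); rewrite arrowsN; lia.
  by have := Pi j; rewrite /= jy.
have AP : mc_set (mclass_of s_gt0 P) P.
  by exists P; [exact: isomorphic_refl|exists [::]].
exists (mclass_of s_gt0 P); first by left; exists P.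
apply: realizes_is_reduced_class; first by left; exists P.
by exists P => //; exists h.
Qed.

Lemma extension_nat_exists n (h : 'I_n -> nat) (P : quiver 'I_n) :
  injective h -> exists Q : Fin, extension h P (val Q).
Proof.
by move=> /(extension_exists P)[Q e]; exists (to_Fin (extension_finite e)).
Qed.

Lemma realizes_exists (A : mclass) : exists Q : Fin, realizes (val Q) A.
Proof.
have [P AP] := mclass_nonempty A.
have [Q e] := extension_nat_exists P (@ord_inj (mc_size A)).
by exists Q, P => //; exists (@nat_of_ord _).
Qed.

(** * Windows, upward-closed sets and the homeomorphism *)

(** Every finite set of naturals lies in some [[0, N)], so these windows suffice to test
    openness. *)
Lemma Fin_openP (W : set Fin) :
  open W <-> forall Q, W Q -> exists N, forall Q' : Fin,
    (forall x y, (x < N)%N -> (y < N)%N -> val Q' x y = val Q x y) -> W Q'.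
Proof.
split=> [[U [D DD <-] <-] Q /= [i Di iQ]|W_open].
  have [N iN] := finite_set_nat_bound (DD i Di).
  exists N => Q' QQ'; exists i => //= x y ix iy.
  by rewrite QQ' ?iQ//; exact: iN.
pose D := [set i : quiver nat * set nat | finite_set i.2 /\
  forall Q : Fin, AF_basic i (val Q) -> W Q].
exists (\bigcup_(i in D) AF_basic i).
  by exists D => // i [].
apply/seteqP; split => [Q [i [_ iW]]|Q WQ]; first exact: iW.
have [N QN] := W_open Q WQ; exists (val Q, `I_N) => //; split => /=.
  exact: finite_II.
by move=> Q' QQ'; apply: QN.
Qed.

Lemma mclass_leP (A B : mclass) :
  mclass_le A B <-> exists P Q, [/\ mc_set A P, mc_set B Q &
    exists2 h, injective h & forall i j, P i j = Q (h i) (h j)].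
Proof.
split=> [[P [Q [AP BQ [V [h hb PQ]]]]]|[P [Q [AP BQ [h hI PQ]]]]].
  exists P, Q; split => //; exists (val \o h) => //.
  exact: inj_comp val_inj (bij_inj hb).
exists P, Q; split => //; exists (range h).
exact: isomorphic_full_subquiver hI _ PQ.
Qed.

(** The window contains the image of [h]. If [P] has no isolated vertex, each [h i] carries an arrow
    inside the window, hence also in [Q'], and so lies in the image of [h']; this embeds [P] into
    [P']. *)
Lemma is_reduced_class_near (Q : Fin) (A : mclass) :
  Mprime A -> realizes (val Q) A ->
  exists N, forall (Q' : Fin) B,
    (forall x y, (x < N)%N -> (y < N)%N -> val Q' x y = val Q x y) ->
    realizes (val Q') B -> mclass_le A B.
Proof.
move=> MA [P AP [h [hI PQ Q0]]].
have [|N hN] := @finite_set_nat_bound (range h).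
  by apply: finite_image; exact: finite_finset.
exists N => Q' B QQ' [P' BP' [h' [h'I PQ' Q'0]]].
apply/mclass_leP; exists P, P'; split => //.
case: MA => [[P1 AP1 P1i]|eA]; last first.
  (* The one-vertex quiver embeds in any member of [B], as sizes are positive and there are no
     loops. *)
  subst A; have [B0 _] := mcP B.
  exists (fun=> Ordinal B0) => [i j _|i j]; first by rewrite !ord1.
  by rewrite quiver1_eq0 quiver_diag.
have /choice[k hk] i : exists j, h' j = h i.
  apply: contrapT => /forallNP/Q'0 Q'i.
  apply: (mclass_isolated AP1 AP P1i (i := i)) => j.
  by rewrite -PQ -QQ' ?Q'i//; apply: hN; eexists.
exists k => [i j kij|i j]; first by apply: hI; rewrite -!hk kij.
by rewrite -PQ' !hk QQ' ?PQ//; apply: hN; eexists.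
Qed.

Lemma realizes_upward_closed (W : set FinSim) : open W ->
  upward_closed [set A | exists2 Q : Fin, W (fin_class Q) & realizes (val Q) A].
Proof.
(* Openness in the quotient unfolds to openness of the preimage under [fin_class]. *)
move=> /Fin_openP W_open A B [Q0 WQ0 rQ0].
move=> /mclass_leP[P [R [AP BR [phi phiI PR]]]].
have [Q e] := extension_nat_exists P (@ord_inj (mc_size A)).
have WQ : W (fin_class Q).
  suff -> : fin_class Q = fin_class Q0 by [].
  apply/fin_class_eq; apply: realizes_fin_sim rQ0.
  by exists P => //; exists (@nat_of_ord _).
have [N QN] := W_open Q WQ.
(* Placement of [R]: its subquiver [P] occupies [[0, mc_size A)], as in [Q], and its other vertices
   go to [M] or beyond, clear of the window and of that copy. *)
pose M := maxn N (mc_size A).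
pose k i := if [pick j | phi j == i] is Some j then nat_of_ord j else (M + i)%N.
have kphi j : k (phi j) = j.
  by rewrite /k; case: pickP => [j' /eqP/phiI->//|/(_ j)]; rewrite eqxx.
have kM i x : k i = x -> (x < M)%N -> exists2 j, phi j = i & x = j :> nat.
  by rewrite /k; case: pickP => [j /eqP <- <-|_ <-]; [exists j|lia].
have kI : injective k.
  move=> i i'; have [/(kM i _ erefl)[j <- _]|] := ltnP (k i) M.
    rewrite kphi => /esym/(kM i')[]; last by move=> j' <- /ord_inj->.
    by rewrite leq_max ltn_ord orbT.
  rewrite /k; case: pickP => [j _|_ _]; first by rewrite leqNgt leq_max ltn_ord orbT.
  case: pickP => [j' _|_ /addnI/ord_inj//].
  by have := ltn_ord j'; rewrite /M; lia.
have [Q' e'] := extension_nat_exists R kI.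
exists Q'; last by exists R => //; exists k.
have [[_ PQ P0] [_ RQ' R0]] := (e, e'); apply: QN.
(* Window vertices off the copy of [P] are isolated in both quivers, so agreement is only at stake
   on the copy. *)
have off x : (x < N)%N -> ~ (x < mc_size A)%N ->
    isolated_vertex (val Q) x /\ isolated_vertex (val Q') x.
  move=> xN xA; split; first by apply: P0 => i ix; apply: xA; rewrite -ix.
  apply: R0 => i /kM[|j _ xj]; first by rewrite leq_max xN.
  by apply: xA; rewrite xj.
move=> x y xN yN.
have [xA|/negP/(off x xN)[Qx Q'x]] := boolP (x < mc_size A)%N; last first.
  by rewrite Qx Q'x.
have [yA|/negP/(off y yN)[Qy Q'y]] := boolP (y < mc_size A)%N; last first.
  by rewrite arrowsN Q'y arrowsN Qy.
rewrite -[x]/(nat_of_ord (Ordinal xA)) -[y]/(nat_of_ord (Ordinal yA)).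
by rewrite PQ PR -RQ' !kphi.
Qed.

Theorem theorem1p7 :
  exists f : FinSim -> Mprime,
    (forall (Q : Fin) (A : Mprime),
        f (fin_class Q) = A <-> is_reduced_class (val Q) (val A)) /\
    homeomorphism f.
Proof.
have reduced (c : FinSim) : exists A : Mprime, is_reduced_class (val (repr c)) (val A).
  have [A MA rA] := is_reduced_class_exists (repr c).
  by exists (SigSub (mem_set MA)).
have [f fP] := choice reduced.
have /choice[g gP] (A : Mprime) : exists c : FinSim,
    exists2 Q, c = fin_class Q & realizes (val Q) (val A).
  have [Q QA] := realizes_exists (val A).
  by exists (fin_class Q), Q.
have MP (A : Mprime) : Mprime (val A) by exact: set_mem (valP A).
have redP (Q : AF) (A : Mprime) : is_reduced_class Q (val A) <-> realizes Q (val A).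
  by split=> [/is_reduced_class_realizes//|/(realizes_is_reduced_class (MP A))].
(* Realization is invariant under [fin_sim], so the value chosen at the canonical representative is
   right for every [Q] in the class. *)
have fE (Q : Fin) A : f (fin_class Q) = A <-> is_reduced_class (val Q) (val A).
  have QQ : fin_sim (repr (fin_class Q)) Q by apply/eqmodP; rewrite reprK.
  have fQ : is_reduced_class (val Q) (val (f (fin_class Q))).
    by apply/redP/(fin_sim_realizes _ QQ)/redP.
  by split=> [<-//|QA]; apply/val_inj/(is_reduced_class_unique fQ QA).
(* Any two quivers realizing [A] are equivalent, so the choice made in [g] does not matter. *)
have gE (Q : Fin) A : realizes (val Q) (val A) -> g A = fin_class Q.
  have [Q' -> Q'A QA] := gP A.
  by apply/fin_class_eq/(realizes_fin_sim Q'A QA).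
exists f; split => //; exists g; split.
- by move=> c; rewrite -[c]reprK; apply/gE/redP/fE.
- by move=> A; have [Q -> QA] := gP A; apply/fE/redP.
- apply/quotient_continuous/continuousP => _ [U U_up <-].
  apply/Fin_openP => Q /= UQ.
  have rQ (Q' : Fin) : realizes (val Q') (val (f (fin_class Q'))).
    by apply/redP/fE.
  have [N NP] := is_reduced_class_near (MP _) (rQ Q).
  by exists N => Q' /NP/(_ (rQ Q')); exact: U_up.
(* The preimage of [W] under [g] is the trace on [Mprime] of an upward-closed set of all classes,
   those realized by quivers in [W]. *)
- apply/continuousP => W W_open.
  exists [set A | exists2 Q : Fin, W (fin_class Q) & realizes (val Q) A].
    exact: realizes_upward_closed.
  apply/seteqP; split => A /=; first by move=> [Q WQ /gE->].
  by have [Q -> QA] := gP A; exists Q.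
Qed.
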